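(* Let $X_1,X_2,\dots,X$ be random elements in a metric space $(E,d)$ equipped with its Borel $\sigma$-algebra $\mathcal{E}$. Further, let $X$ take values almost surely in a separable subset $E_0\in\mathcal{E}$. Then $$X_n\to X \text{ in distribution as } n\to\infty$$ if and only if there is a coupling $(\hat X_1,\hat X_2,\dots,\hat X)$ of $X_1,X_2,\dots,X$ such that $$\hat X_n\to\hat X \text{ pointwise as } n\to\infty.$$
   Context: Convergence in distribution: with $P_n$ and $P$ the distributions of $X_n$ and $X$ on $(E,\mathcal{E})$, $X_n\to X$ in distribution means $\int h\,\mathrm{d}P_n\to\int h\,\mathrm{d}P$ as $n\to\infty$ for all bounded continuous $h:E\to\mathbb{R}$. Coupling: a coupling of $X_1,X_2,\dots,X$ (possibly defined on different probability spaces) is a family $(\hat X_1,\hat X_2,\dots,\hat X)$ of random elements in $(E,\mathcal{E})$ defined on a common probability space such that each $\hat X_n$ has the same distribution as $X_n$ and $\hat X$ has the same distribution as $X$. Pointwise convergence: $d(\hat X_n(\omega),\hat X(\omega))\to0$ as $n\to\infty$ for every $\omega$ in the common probability space. *)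

(* Defs.v *)
From HB Require Import structures.
From mathcomp Require Import all_boot all_order all_algebra.
From mathcomp Require Import all_classical all_reals all_analysis.
Import Order.TTheory GRing.Theory Num.Theory.
Import numFieldNormedType.Exports.

Set Implicit Arguments.
Unset Strict Implicit.
Unset Printing Implicit Defensive.

Local Open Scope classical_set_scope.
Local Open Scope ring_scope.

(* The base point, which [measurableType] demands, says no more than that the
   space is nonempty; any space carrying a random element is. *)
#[short(type="pmetricType")]
HB.structure Definition PointedMetric (R : numDomainType) :=
  {E of Pointed E & Metric R E}.

Notation borel E := (g_sigma_algebraType (@open E)).

(* Existence of a countable dense subset for the subspace topology of [A]. *)
Definition separable_set (T : topologicalType) (A : set T) :=
  exists D : set T, [/\ countable D, D `<=` A & A `<=` closure D].

Definition cvg_in_distribution (R : realType) (E : pmetricType R)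
    (d_ : nat -> measure_display) (T_ : forall n, measurableType (d_ n))
    (P_ : forall n, probability (T_ n) R)
    (X_ : forall n, {RV (P_ n) >-> borel E})
    (d : measure_display) (T : measurableType d) (P : probability T R)
    (X : {RV P >-> borel E}) :=
  forall h : E -> R, continuous h -> bounded_fun h ->
    (\int[distribution (P_ n) (X_ n)]_x (h x)%:E @[n --> \oo] -->
      \int[distribution P X]_x (h x)%:E)%E.

(* Compared on measurable sets only: as a Rocq function, a measure also takes
   (meaningless) values on nonmeasurable sets. *)
Definition same_distribution (R : realType)
    (d' : measure_display) (T' : measurableType d')
    (d1 : measure_display) (T1 : measurableType d1) (P1 : probability T1 R)
    (X1 : {RV P1 >-> T'})
    (d2 : measure_display) (T2 : measurableType d2) (P2 : probability T2 R)
    (X2 : {RV P2 >-> T'}) :=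
  forall A : set T', measurable A -> distribution P1 X1 A = distribution P2 X2 A.

Definition coupling (R : realType)
    (d' : measure_display) (T' : measurableType d')
    (d_ : nat -> measure_display) (T_ : forall n, measurableType (d_ n))
    (P_ : forall n, probability (T_ n) R)
    (X_ : forall n, {RV (P_ n) >-> T'})
    (d : measure_display) (T : measurableType d) (P : probability T R)
    (X : {RV P >-> T'})
    (dO : measure_display) (O : measurableType dO) (Q : probability O R)
    (Y_ : nat -> {RV Q >-> T'}) (Y : {RV Q >-> T'}) :=
  (forall n, same_distribution (Y_ n) (X_ n)) /\ same_distribution Y X.

Definition cvg_pointwise (R : realType) (E : pmetricType R) (O : Type)
    (Y_ : nat -> O -> E) (Y : O -> E) :=
  forall w : O, mdist (Y_ n w) (Y w) @[n --> \oo] --> (0 : R).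

(* Main.v *)
Require Import Defs.
From HB Require Import structures.
From mathcomp Require Import all_boot all_order all_algebra.
From mathcomp Require Import all_classical all_reals all_analysis.
From mathcomp Require Import measurable_realfun ring lra.
Import Order.TTheory GRing.Theory Num.Theory.
Import numFieldNormedType.Exports.

(* If the coupling converges pointwise, dominated convergence gives convergence in
   distribution.  Conversely, fix for each k finitely many disjoint open cells
   {g > 0}, g continuous, of diameter less than 1/(k+1), whose union has
   mu-measure at least 1 - 2^-(k+1): balls centred at a dense sequence of E0 whose
   spheres are mu-null, each deprived of the preceding closed balls.  Since
   liminf mu_n{g > 0} >= mu{g > 0}, there are levels l(n) -> oo with
   mu_n(G) >= (1 - 1/(l(n)+1)) mu(G) for every cell G of level l(n).  Hence mu_n is
   a mixture that uses, with weight (1 - 1/(l(n)+1)) mu(G), its conditional law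
   on G, and with the remaining weight some residual law.  Take Y of law mu, an
   independent uniform u, and, independent of both, random elements V_(n,j)
   having all these component laws.  If u <= 1 - 1/(l(n)+1) and Y lies in the
   j-th cell of level l(n), let Y_n = V_(n,j); otherwise let Y_n be the residual
   element.  By Borel-Cantelli, almost surely Y_n and Y eventually share a cell;
   on the exceptional null set, all variables are reset to a fixed point.

   E being an arbitrary metric space, the V_(n,j) need not live on [0,1].  They are
   the coordinates of an infinite product, obtained by Caratheodory's theorem
   from the outer measure of covers by cylinders; no topology is needed for
   this. *)

Local Open Scope classical_set_scope.
Local Open Scope ring_scope.

(** * Random elements with countably many prescribed laws *)

Section CouplingOfLaws.
Context {R : realType} {d : measure_display} {S : measurableType d}.
Variable nu : nat -> probability S R.
Local Open Scope ereal_scope.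

(** A code is a length with a full sequence of bases, only the first [r.1] of which count; cylinders
    of all lengths thus share one type. *)
Definition cylinder (r : nat * (nat -> set S)) : set (nat -> S) :=
  [set w | forall i, (i < r.1)%N -> r.2 i (w i)].

Definition measurable_base (r : nat * (nat -> set S)) :=
  forall i, measurable (r.2 i).

(* The mass of the cylinder once its first [n] coordinates are frozen at those of [x]. *)
Definition section_mass (n : nat) (x : nat -> S) (r : nat * (nat -> set S)) : R :=
  (\prod_(i < r.1) (if (i < n)%N then \1_(r.2 i) (x i) else fine (nu i (r.2 i))))%R.

(** The infimum over codes defines a mass on every set at once, without comparing different codes of
    one cylinder. *)
Definition cylinder_mass (A : set (nat -> S)) : \bar R :=
  ereal_inf [set (section_mass 0 point r)%:E |
    r in [set r | measurable_base r /\ A `<=` cylinder r]].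

Lemma section_mass_ge0 n x r : (0 <= section_mass n x r)%R.
Proof. by apply: prodr_ge0 => i _; case: ifP => _; rewrite ?fine_ge0// indicE. Qed.

Lemma section_mass_frozen n x y r : (forall i, (i < n)%N -> x i = y i) ->
  section_mass n x r = section_mass n y r.
Proof. by move=> xy; apply: eq_bigr => i _; case: ifP => // /xy ->. Qed.

Lemma section_mass_cylinder x r n : cylinder r x -> (r.1 <= n)%N ->
  section_mass n x r = 1%R.
Proof.
move=> rx rn; rewrite /section_mass big1// => i _.
by rewrite (leq_trans (ltn_ord i) rn) indicE mem_set//; exact: rx.
Qed.

Definition update (x : nat -> S) n (y : S) : nat -> S :=
  fun i => if i == n then y else x i.

(** The variable [y] enters through a single factor; measurability in [y] and the integral are read
    off from this form. *)
Lemma section_mass_update n x y r : section_mass n.+1 (update x n y) r =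
  ((\prod_(i < r.1 | i != n :> nat)
     (if (i < n)%N then \1_(r.2 i) (x i) else fine (nu i (r.2 i)))) *
   (if (n < r.1)%N then \1_(r.2 n) y else 1))%R.
Proof.
have E (i : 'I_r.1) : i != n :> nat ->
    (if (i < n.+1)%N then \1_(r.2 i) (update x n y i) else fine (nu i (r.2 i)))%R =
    (if (i < n)%N then \1_(r.2 i) (x i) else fine (nu i (r.2 i)))%R.
  by move=> /[dup] ni /negbTE ni'; rewrite /update ni' ltnS leq_eqVlt ni'.
rewrite /section_mass; case: ifPn => [nr|]; last first.
  rewrite -leqNgt => rn; rewrite mulr1.
  rewrite [RHS](eq_bigl xpredT); last first.
    by move=> i /=; rewrite ltn_eqF// (leq_trans (ltn_ord i)).
  by apply: eq_bigr => i _; rewrite E// ltn_eqF// (leq_trans (ltn_ord i)).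
rewrite (bigD1 (Ordinal nr))//= ltnSn /update eqxx mulrC; congr (_ * _)%R.
by apply: eq_big => [i|i]; [rewrite -val_eqE|exact: E].
Qed.

Lemma measurable_section_mass n x r : measurable_base r ->
  measurable_fun setT (fun y => section_mass n.+1 (update x n y) r).
Proof.
move=> mr; under eq_fun do rewrite section_mass_update.
apply: measurable_funM; first exact: measurable_cst.
by case: (n < _)%N; [exact: measurable_indic|exact: measurable_cst].
Qed.

Lemma integral_section_mass n x r : measurable_base r ->
  \int[nu n]_y (section_mass n.+1 (update x n y) r)%:E = (section_mass n x r)%:E.
Proof.
move=> mr; under eq_integral do rewrite section_mass_update EFinM.
rewrite ge0_integralZl//; last 3 first.
- by apply/measurable_EFinP; case: (n < _)%N;
    [exact: measurable_indic|exact: measurable_cst].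
- by move=> y _; case: (n < _)%N; rewrite lee_fin// indicE.
- rewrite lee_fin; apply: prodr_ge0 => i _.
  by case: ifP => _; rewrite ?fine_ge0// indicE.
rewrite /section_mass; case: (ltnP n r.1) => [nr|rn].
  rewrite integral_indic// setIT [in RHS](bigD1 (Ordinal nr))//= ltnn [in RHS]mulrC.
  rewrite EFinM fineK ?fin_num_measure//; congr (_%:E * _).
rewrite integral_cst// mul1e [X in _ * X](_ : _ = 1); last exact: probability_setT.
rewrite mule1; congr (_%:E).
by apply: eq_bigl => i /=; rewrite ltn_eqF// (leq_trans (ltn_ord i)).
Qed.

(* Integrating over the [n]-th coordinate averages the masses of the sections. *)
Lemma section_mass_step n x (F : nat -> nat * (nat -> set S)) :
  (forall k, measurable_base (F k)) ->
  \sum_(k <oo) (section_mass n x (F k))%:E < 1 ->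
  exists y, \sum_(k <oo) (section_mass n.+1 (update x n y) (F k))%:E < 1.
Proof.
move=> mF; apply: contraPP => /forallNP H; apply/negP; rewrite -leNgt.
under eq_eseriesr do rewrite -integral_section_mass//.
rewrite -integral_nneseries//; last 2 first.
- by move=> k; apply/measurable_EFinP; exact: measurable_section_mass.
- by move=> k y _; rewrite lee_fin section_mass_ge0.
rewrite -(probability_setT (nu n)) -[leLHS]mul1e -integral_cst//.
apply: ge0_le_integral => //.
- apply: ge0_emeasurable_sum => [k y _ _|k _]; first by rewrite lee_fin section_mass_ge0.
  by apply/measurable_EFinP; exact: measurable_section_mass.
- by move=> y _ /=; rewrite leNgt; apply/negP; exact: H.
Qed.

(* Otherwise one fixes the coordinates one at a time, keeping the total mass of the
   sections below 1; a cylinder containing the resulting point has a section of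
   mass 1 once its base is exhausted (S. Saeki's argument). *)
Lemma cylinder_cover_mass (F : nat -> nat * (nat -> set S)) :
  (forall k, measurable_base (F k)) -> setT `<=` \bigcup_k cylinder (F k) ->
  1 <= \sum_(k <oo) (section_mass 0 point (F k))%:E.
Proof.
move=> mF cF; rewrite leNgt; apply/negP => F1.
pose good n x := \sum_(k <oo) (section_mass n x (F k))%:E < 1.
have [next nextP] : {next : nat * (nat -> S) -> S &
    forall p, good p.1 p.2 -> good p.1.+1 (update p.2 p.1 (next p))}.
  apply: (@choice _ _ (fun p y => good p.1 p.2 -> good p.1.+1 (update p.2 p.1 y))) => p.
  have [/(section_mass_step _ _ _ mF) [y ?]|] := pselect (good p.1 p.2); first by exists y.
  by exists point.
pose X := fix X n : nat -> S :=
  if n is n'.+1 then update (X n') n' (next (n', X n')) else point.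
have goodX n : good n (X n).
  by elim: n => [//|n /(nextP (n, _))].
have XE n i : (i < n)%N -> X n i = X i.+1 i.
  elim: n => // n IH; rewrite ltnS leq_eqVlt => /predU1P[->//|i_n].
  by rewrite -IH// [LHS]/= {1}/update ltn_eqF.
(* Coordinate [i] is fixed at stage [i.+1] and never changes again, so the diagonal point agrees
   with [X n] on the first [n] coordinates. *)
have [k _ kX] := cF (fun i => X i.+1 i) I.
have := goodX (F k).1; rewrite /good ltNge => /negP; apply.
have -> : 1 = (section_mass (F k).1 (X (F k).1) (F k))%:E.
  rewrite (section_mass_frozen _ _ (fun i => X i.+1 i)); last by move=> i /XE.
  by rewrite section_mass_cylinder.
rewrite (@nneseriesD1 _ _ k)// ?leeDl// ?nneseries_ge0// => *;
  by rewrite lee_fin section_mass_ge0.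
Qed.

(** * The outer measure generated by cylinders *)

Lemma cylinder_mass_ge0 A : 0 <= cylinder_mass A.
Proof.
by apply: le_ereal_inf_tmp => _ [r _ <-]; rewrite lee_fin section_mass_ge0.
Qed.

Lemma cylinder_mass0 : cylinder_mass set0 = 0.
Proof.
apply/eqP; rewrite eq_le cylinder_mass_ge0 andbT; apply: ereal_inf_lbound.
exists (1%N, fun=> set0).
  by split=> [i /=|w []]; exact: measurable0.
by rewrite /section_mass big_ord1/= measure0.
Qed.


(* [mu_ext] wants a semiring of sets; the power set imposes no restriction on the
   covers. *)
Notation discrete := (g_sigma_algebraType [set: set (nat -> S)]).

Definition product_outer_measure : set (nat -> S) -> \bar R :=
  @mu_ext _ discrete R cylinder_mass.

HB.instance Definition _ := isOuterMeasure.Build R (nat -> S)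
  product_outer_measure
  (@mu_ext0 _ discrete R _ cylinder_mass0 cylinder_mass_ge0)
  (@mu_ext_ge0 _ discrete R _ cylinder_mass_ge0)
  (@le_mu_ext _ discrete R _)
  (@mu_ext_sigma_subadditive _ discrete R _ cylinder_mass_ge0).

(** Each set of a cover is enclosed in one cylinder, up to an error [e / 2 ^ k.+1]; these cylinders
    cover the space, and [cylinder_cover_mass] applies. *)
Lemma product_outer_measure_setT : 1 <= product_outer_measure setT.
Proof.
apply: le_ereal_inf_tmp => _ [A [_ cA] <-].
apply/lee_addgt0Pr => e e0.
have [->|sA] := eqVneq (\sum_(k <oo) cylinder_mass (A k)) +oo.
  by rewrite addye// leey.
have Afin k : cylinder_mass (A k) \is a fin_num.
  rewrite ge0_fin_numE ?cylinder_mass_ge0// ltey; apply: contra_neq sA => Ak.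
  by apply: (eseries_pinfty _ _ Ak) => // n _; rewrite -ltNye (lt_le_trans _ (cylinder_mass_ge0 _)).
have H k : exists r, [/\ measurable_base r, A k `<=` cylinder r &
    (section_mass 0 point r)%:E <= cylinder_mass (A k) + (e / (2 ^ k.+1)%:R)%:E].
  have ek : (0 < e / (2 ^ k.+1)%:R)%R by rewrite divr_gt0// ltr0n expn_gt0.
  have [_ [r [mr Ar] <-] rk] := lb_ereal_inf_adherent ek (Afin k).
  by exists r; split=> //; exact: ltW.
have [F HF] := choice H.
apply: le_trans (epsilon_trick xpredT (fun k => cylinder_mass_ge0 (A k)) (ltW e0)).
apply: le_trans (cylinder_cover_mass F _ _) _.
- by move=> k; have [] := HF k.
- by move=> w /cA [k _ Akw]; exists k => //; have [_ + _] := HF k; exact.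
- apply: lee_nneseries => [k _ _|k _]; first by rewrite lee_fin section_mass_ge0.
  by have [] := HF k.
Qed.

(** * Measurability and mass of the coordinate events *)

Let coord (n : nat) (A : set S) : set (nat -> S) := [set w | A (w n)].

(** The length is raised to at least [n.+1] so that the constraint at [n] counts; new bases are
    filled with [setT]. *)
Let restrict_base n (A : set S) (r : nat * (nat -> set S)) : nat * (nat -> set S) :=
  (maxn r.1 n.+1, fun i => (if (i < r.1)%N then r.2 i else setT) `&`
                           (if i == n then A else setT)).

Lemma measurable_restrict_base n A r : measurable A -> measurable_base r ->
  measurable_base (restrict_base n A r).
Proof.
move=> mA mr i /=.
by apply: measurableI; [case: ifP => // _; exact: mr|case: ifP].
Qed.

Lemma cylinder_restrict_base n A r :
  cylinder r `&` coord n A `<=` cylinder (restrict_base n A r).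
Proof.
move=> w [rw Aw] i /= _; split; first by case: ifP => //; exact: rw.
by case: eqP => // ->.
Qed.

(** The two codes differ only in the factor at [n], where [nu n] is additive; the padding
    contributes factors 1. *)
Lemma section_mass_restrict_baseC n A r : measurable A -> measurable_base r ->
  (section_mass 0 point (restrict_base n A r) +
   section_mass 0 point (restrict_base n (~` A) r) = section_mass 0 point r)%R.
Proof.
move=> mA mr; set N := maxn r.1 n.+1.
have nN : (n < N)%N by rewrite leq_max ltnSn orbT.
pose c i := (if (i < r.1)%N then r.2 i else setT).
have mc i : measurable (c i) by rewrite /c; case: ifP => // _; exact: mr.
have -> : section_mass 0 point r = (\prod_(i < N) fine (nu i (c i)))%R.
  rewrite /section_mass/= (big_ord_widen N (fun i => fine (nu i (r.2 i)))); last first.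
    by rewrite leq_max leqnn.
  rewrite big_mkcond/=; apply: eq_bigr => i _; rewrite /c; case: ifP => // _.
  by rewrite probability_setT.
have E B : section_mass 0 point (restrict_base n B r) =
    (fine (nu n (c n `&` B)) * \prod_(i < N | i != n :> nat) fine (nu i (c i)))%R.
  rewrite /section_mass (bigD1 (Ordinal nN))//= eqxx; congr (_ * _)%R.
  apply: eq_big => [i|i]; rewrite -val_eqE//= => /negbTE ->.
  by rewrite setIT.
rewrite !E -mulrDl [RHS](bigD1 (Ordinal nN))//=; congr (_ * _)%R.
rewrite -fineD ?fin_num_measure//; last 2 first.
- exact: measurableI.
- by apply: measurableI => //; exact: measurableC.
congr fine; rewrite -measureU//.
- by rewrite -setIUr setUv setIT.
- exact: measurableI.
- by apply: measurableI => //; exact: measurableC.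
- by rewrite setIACA setICr setI0.
Qed.

Lemma cylinder_mass_split n A B : measurable A ->
  cylinder_mass (B `&` coord n A) + cylinder_mass (B `&` ~` coord n A) <=
  cylinder_mass B.
Proof.
move=> mA; apply: le_ereal_inf_tmp => _ [r [mr Br] <-].
rewrite -(section_mass_restrict_baseC n A)// EFinD.
have H C : measurable C -> cylinder_mass (B `&` coord n C) <=
    (section_mass 0 point (restrict_base n C r))%:E.
  move=> mC; apply: ereal_inf_lbound; exists (restrict_base n C r) => //; split.
    exact: measurable_restrict_base.
  by move=> w [Bw Cw]; apply: cylinder_restrict_base; split=> //; exact: Br.
by apply: leeD; apply: H => //; exact: measurableC.
Qed.

(** Every member of a cover of [X] is cut along [coord n A]; [cylinder_mass_split] is then summed
    over the cover. *)
Lemma caratheodory_coord n A : measurable A ->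
  (caratheodory_measurable product_outer_measure) (coord n A).
Proof.
move=> mA; apply: le_caratheodory_measurable => X.
apply: le_ereal_inf_tmp => _ [B [_ XB] <-].
have mdisc (C : set discrete) : measurable C by exact: sub_sigma_algebra.
apply: (@le_trans _ _ (\sum_(k <oo) cylinder_mass (B k `&` coord n A) +
    \sum_(k <oo) cylinder_mass (B k `&` ~` coord n A))).
  apply: leeD; apply: ereal_inf_lbound.
  - exists (fun k => B k `&` coord n A) => //; split=> [//|].
    by rewrite -setI_bigcupl; exact: setSI.
  - exists (fun k => B k `&` ~` coord n A) => //; split=> [//|].
    by rewrite -setI_bigcupl; exact: setSI.
rewrite -nneseriesD; last 2 first.
- by move=> *; exact: cylinder_mass_ge0.
- by move=> *; exact: cylinder_mass_ge0.
apply: lee_nneseries => [k _ _|k _]; last exact: cylinder_mass_split.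
by rewrite adde_ge0 ?cylinder_mass_ge0.
Qed.

Lemma product_outer_measure_coord_le n A : measurable A ->
  product_outer_measure (coord n A) <= nu n A.
Proof.
move=> mA; pose r := (n.+1, fun i => if i == n then A else setT).
pose B k := if k is 0%N then coord n A else set0.
apply: (@le_trans _ _ (\sum_(k <oo) cylinder_mass (B k))).
  apply: ereal_inf_lbound; exists B => //; split=> [i|w Aw]; first exact: sub_sigma_algebra.
  by exists 0%N.
rewrite (@nneseriesD1 _ _ 0)//; last by move=> *; exact: cylinder_mass_ge0.
rewrite eseries0 ?adde0; last by case=> //= *; exact: cylinder_mass0.
apply: (@le_trans _ _ (section_mass 0 point r)%:E).
  apply: ereal_inf_lbound; exists r => //; split=> [i/=|w Aw i /= _]; first by case: ifP.
  by case: eqP => // ->.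
rewrite /section_mass big_ord_recr/= eqxx big1 => [|i _]; last first.
  by rewrite ltn_eqF// probability_setT.
by rewrite mul1r fineK// fin_num_measure.
Qed.

(** The upper bounds for [A] and its complement add up to 1, while the two outer measures add up to
    at least 1 by Caratheodory splitting; so both bounds are attained. *)
Lemma product_outer_measure_coord n A : measurable A ->
  product_outer_measure (coord n A) = nu n A.
Proof.
move=> mA; apply/eqP; rewrite eq_le product_outer_measure_coord_le//=.
have le_nu := product_outer_measure_coord_le n A mA.
have := product_outer_measure_setT.
rewrite (caratheodory_coord n A mA setT) !setTI.
move=> /le_trans /(_ (leeD2l _ (product_outer_measure_coord_le n _ (measurableC mA)))).
have fx : product_outer_measure (coord n A) \is a fin_num.
  rewrite ge0_fin_numE ?outer_measure_ge0// (le_lt_trans le_nu)//.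
  by rewrite -ge0_fin_numE// fin_num_measure.
rewrite probability_setC//; have fp : nu n A \is a fin_num by exact: fin_num_measure.
by rewrite -(fineK fx) -(fineK fp) -EFinB -EFinD !lee_fin; lra.
Qed.

Lemma product_outer_measureT : product_outer_measure setT = 1.
Proof.
by have := product_outer_measure_coord 0 setT measurableT; rewrite probability_setT.
Qed.

Lemma exists_coupling_of_laws : exists (dO : measure_display) (O : measurableType dO)
    (Q : probability O R) (V : nat -> O -> S), forall n,
  measurable_fun setT (V n) /\
  forall A, measurable A -> Q (V n @^-1` A) = nu n A.
Proof.
pose mu : {outer_measure set (nat -> S) -> \bar R} := product_outer_measure.
pose m : {measure set (caratheodory_type mu) -> \bar R} :=
  (mu : set (caratheodory_type mu) -> \bar R).
(* Normalising only packages [m] as a probability: its total mass is already 1. *)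
exists _, (caratheodory_type mu), (mnormalize m (dirac point)), (fun n w => w n).
move=> n; split.
  by move=> _ A mA; rewrite setTI; exact: caratheodory_coord.
have mT : m setT = 1 by exact: product_outer_measureT.
have mE B : mnormalize m (dirac point) B = m B.
  by rewrite /mnormalize mT onee_eq0/= invr1 mule1.
move=> A mA; rewrite -(product_outer_measure_coord n A mA); exact: mE.
Qed.

End CouplingOfLaws.

(** * Convergence in distribution and open sets *)

Lemma continuous_measurable_borel {R : realType} {E : pmetricType R} (h : E -> R) :
  continuous h -> measurable_fun setT (h : borel E -> R).
Proof.
move=> ch; apply: (measurability (@RGenOpens.G R)); first exact: RGenOpens.measurableE.
move=> _ [_ [a [b ->]] <-]; rewrite setTI; apply: sub_sigma_algebra.
apply: open_comp => [x _|]; first exact: ch.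
exact: interval_open.
Qed.

Section Portmanteau.
Context {R : realType} {E : pmetricType R}.
Variables (mu_ : nat -> probability (borel E) R) (mu : probability (borel E) R).
Hypothesis mu_cvg : forall h : E -> R, continuous h -> bounded_fun h ->
  (\int[mu_ n]_x (h x)%:E @[n --> \oo] --> \int[mu]_x (h x)%:E)%E.
Local Open Scope ereal_scope.

(** The open-set half of the portmanteau theorem: the masses of the sets [F m] increase to that of
    [G], and a bounded continuous [h] fits between the indicators of [F m] and [G]. *)
Lemma near_lt_mass_pos (g : E -> R) (c : R) : continuous g ->
  c%:E < mu [set x | (0 < g x)%R] ->
  \forall n \near \oo, c%:E < mu_ n [set x | (0 < g x)%R].
Proof.
move=> cg cG; set G := [set x | (0 < g x)%R].
have mg := continuous_measurable_borel g cg.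
have mG : measurable (G : set (borel E)).
  have := mg measurableT `]0%R, +oo[%classic (measurable_itv _).
  by rewrite setTI; congr measurable; apply/seteqP; split=> x /=;
    rewrite in_itv/= andbT.
pose F m : set (borel E) := [set x | (1 <= m%:R * g x)%R].
have mF m : measurable (F m).
  have mh : measurable_fun setT (fun x : borel E => m%:R * g x)%R.
    by apply: measurable_funM => //; exact: measurable_cst.
  have := mh measurableT `[1%R, +oo[%classic (measurable_itv _).
  by rewrite setTI; congr measurable; apply/seteqP; split=> x /=;
    rewrite in_itv/= andbT.
have FG : \bigcup_m F m = G.
  apply/seteqP; split=> x.
    move=> [m _]; rewrite /F /G/= => H; rewrite ltNge; apply/negP => gx.
    by have := lt_le_trans ltr01 (le_trans H (mulr_ge0_le0 (ler0n _ m) gx)); rewrite ltxx.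
  move=> gx; exists (Num.bound (g x)^-1) => //; rewrite /F/=.
  rewrite -ler_pdivrMr// div1r ltW//.
  by rewrite archi_boundP// invr_ge0 ltW.
have [m cF] : exists m, c%:E < mu (F m).
  have Fcvg : mu (F m) @[m --> \oo] --> mu G.
    rewrite -FG; apply: nondecreasing_cvg_mu => //.
      by rewrite FG.
    move=> m n mn; apply/subsetPset => x Fx; have : G x by rewrite -FG; exists m.
    by move=> gx; apply: le_trans Fx _; rewrite ler_wpM2r ?ler_nat// ltW.
  have [N _ cN] := Fcvg _ (open_ereal_gt' cG).
  by exists N; apply: cN => /=.
(* As [|t| + t] is twice the positive part of t, [h] vanishes off [G] and equals 1 on [F m]. *)
pose h x := Num.min 1%R (`|m%:R * g x| + m%:R * g x)%R.
have ch : continuous h.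
  move=> x; apply: (@continuous_min R E (fun=> 1%R) (fun x => `|m%:R * g x| + m%:R * g x)%R).
    exact: cvg_cst.
  have cm : (m%:R * g y)%R @[y --> x] --> (m%:R * g x)%R.
    by apply: cvgM; [exact: cvg_cst|exact: cg].
  by apply: cvgD => //; exact: cvg_norm.
have h0 x : (0 <= h x)%R.
  by rewrite le_min ler01/= -lerBlDr sub0r -normrN ler_norm.
have h1 x : (h x <= 1)%R by rewrite ge_min lexx.
have bh : bounded_fun h.
  exists 1%R; split; first exact: num_real.
  by move=> M M1 x _ /=; rewrite ger0_norm// (le_trans (h1 x))// ltW.
have mh : measurable_fun setT (h : borel E -> R) by exact: continuous_measurable_borel.
have Fh : c%:E < \int[mu]_x (h x)%:E.
  apply: lt_le_trans cF _; have -> : mu (F m) = \int[mu]_x (\1_(F m) x)%:E.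
    by rewrite integral_indic// setIT.
  apply: ge0_le_integral => //.
  - by apply/measurable_EFinP; exact: measurable_indic.
  - by apply/measurable_EFinP.
  - move=> x _; rewrite lee_fin indicE; case: (boolP (x \in F m)) => [|_] //.
    rewrite inE /F/= /h => Fx; rewrite le_min lexx/= (le_trans Fx)// lerDr//.
have hG n : \int[mu_ n]_x (h x)%:E <= mu_ n G.
  have -> : mu_ n G = \int[mu_ n]_x (\1_(G : set (borel E)) x)%:E.
    by rewrite integral_indic// setIT.
  apply: ge0_le_integral => //.
  - by move=> x _; rewrite lee_fin.
  - by apply/measurable_EFinP.
  - by apply/measurable_EFinP; exact: measurable_indic.
  - move=> x _; rewrite lee_fin indicE; case: (boolP (x \in G)) => [//|].
    rewrite notin_setE /G/= => /negP; rewrite -leNgt => gx.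
    rewrite /h ge_min ler0_norm ?addNr ?lexx ?orbT//.
    by rewrite mulr_ge0_le0.
have H : \forall n \near \oo, c%:E < \int[mu_ n]_x (h x)%:E.
  exact: (mu_cvg h ch bh _ (open_ereal_gt' Fh)).
by apply: filterS H => n H; exact: lt_le_trans H (hG n).
Qed.

End Portmanteau.

(** * Partition into small cells *)

Section SmallCells.
Context {R : realType} {E : pmetricType R}.

Lemma mdist_continuous (x : E) : continuous (mdist x : E -> R).
Proof.
move=> y; apply/cvgrPdist_lt => /= e e0.
near=> z; have : ball y e z by near: z; exact: nbhsx_ballx.
rewrite ballEmdist/= => yz; rewrite ltr_norml.
have := metric_triangle x y z; have := metric_triangle x z y.
rewrite (metric_sym z y); lra.
Unshelve. all: by end_near. Qed.

(** The law of the distance to [x] has countably many atoms, whereas an interval of positive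
    Lebesgue measure is uncountable. *)
Lemma exists_null_sphere (mu : probability (borel E) R) (x : E) (a b : R) : a < b ->
  exists r, [/\ a < r, r < b & mu [set y | mdist x y = r] = 0%E].
Proof.
move=> ab.
have mx := continuous_measurable_borel _ (mdist_continuous x).
pose X : {RV mu >-> R} := mfun_Sub (mem_set mx : (mdist x : borel E -> R) \in mfun).
have cX := pmf_gt0_countable X.
have : ~ (`]a, b[%classic `<=` [set r | 0 < pmf X r]).
  move=> /subset_card_le /sub_countable /(_ cX) /countable_lebesgue_measure0.
  rewrite lebesgue_measure_itv/= lte_fin ab -EFinD => -[] /eqP.
  by rewrite subr_eq0 gt_eqF.
move=> /existsNP[r /not_implyP[]]; rewrite /= in_itv/= => /andP[ar rb] /negP.
rewrite -leNgt => r0; exists r; split=> //.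
have mr : measurable ([set y | mdist x y = r] : set (borel E)).
  by have := mx measurableT [set r] (measurable_set1 r); rewrite setTI.
rewrite -[LHS]fineK ?fin_num_measure//; congr (_%:E).
by apply/eqP; rewrite eq_le r0 fine_ge0.
Qed.

Lemma countable_sub_range {T : pointedType} (D : set T) : countable D ->
  exists e : nat -> T, D `<=` range e.
Proof.
move=> /countable_injP[f finj].
exists (fun n => xget point (D `&` [set x | f x = n])) => x Dx; exists (f x) => //.
case: xgetP => [y _ [Dy /= fy]|/(_ x)[]//].
by apply: finj => //; exact: mem_set.
Qed.

(** A cell is given by a continuous function positive exactly on it, the form in which
    [near_lt_mass_pos] handles open sets. *)
Fixpoint ball_minus (c : nat -> E) (r : nat -> R) (j n : nat) : E -> R :=
  if n is n'.+1 then ball_minus c r j n' \min (fun y => mdist (c n') y - r n')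
  else fun y => r j - mdist (c j) y.

Lemma ball_minus_gt0 c r j n y : 0 < ball_minus c r j n y <->
  mdist (c j) y < r j /\ forall l, (l < n)%N -> r l < mdist (c l) y.
Proof.
elim: n => [|n IH] /=; first by rewrite subr_gt0; split=> [|[]].
rewrite lt_min subr_gt0; split=> [/andP[/IH[jy H] ny]|[jy H]].
  by split=> // l; rewrite ltnS leq_eqVlt => /predU1P[->//|]; exact: H.
apply/andP; split; last exact: H.
by apply/IH; split=> // l ln; apply: H; rewrite ltnS ltnW.
Qed.

Lemma ball_minus_continuous c r j n : continuous (ball_minus c r j n).
Proof.
elim: n => [|n IH] /= y.
  by apply: cvgB; [exact: cvg_cst|exact: mdist_continuous].
apply: (@continuous_min R E); first exact: IH.
by apply: cvgB; [exact: mdist_continuous|exact: cvg_cst].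
Qed.

(** Off the null spheres, a point of [E0] lies in the cell of the first ball containing it; so all
    cells together have full mass, and finitely many of them suffice. *)
Lemma small_disjoint_cells (mu : probability (borel E) R) (E0 : set E) (e : R) :
  measurable (E0 : set (borel E)) -> separable_set E0 -> mu E0 = 1%E -> 0 < e ->
  exists (m : nat) (g : nat -> E -> R), [/\ forall j, continuous (g j),
    trivIset setT (fun j => [set x | 0 < g j x]),
    forall j x y, 0 < g j x -> 0 < g j y -> mdist x y < e &
    ((1 - e)%:E < mu (\bigcup_(j < m) [set x | (0 < g j x)%R]))%E].
Proof.
move=> mE0 [D [cD DE0 E0D]] muE0 e0.
have [c Dc] := countable_sub_range D cD.
(* Radii below [e / 2] keep the diameters under [e]; radii above [e / 4] make the balls cover [E0],
   each point of which is within [e / 4] of some centre. *)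
have [r Hr] := choice (fun j =>
  exists_null_sphere mu (c j) (e / 4) (e / 2) ltac:(lra)).
pose g j := ball_minus c r j j.
have cg j : continuous (g j) by exact: ball_minus_continuous.
pose G j : set (borel E) := [set x | 0 < g j x].
have mG j : measurable (G j).
  have := continuous_measurable_borel _ (cg j) measurableT `]0%R, +oo[%classic
    (measurable_itv _).
  by rewrite setTI; congr measurable; apply/seteqP; split=> x /=;
    rewrite in_itv/= andbT.
have tG : trivIset setT G.
  apply/trivIsetP => i j _ _ ij; apply/seteqP; split=> [x|//] [].
  rewrite /G/= /g => /ball_minus_gt0[ix Hi] /ball_minus_gt0[jx Hj].
  by move: ij; rewrite neq_ltn => /orP[/Hj|/Hi]; rewrite ltNge ltW.
have smallG j x y : 0 < g j x -> 0 < g j y -> mdist x y < e.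
  move=> /ball_minus_gt0[jx _] /ball_minus_gt0[jy _].
  have := metric_triangle x (c j) y; rewrite (metric_sym x (c j)).
  have [_ rj _] := Hr j; lra.
pose S j : set (borel E) := [set y | mdist (c j) y = r j].
have mS j : measurable (S j).
  have := continuous_measurable_borel _ (mdist_continuous (c j)) measurableT
    [set r j] (measurable_set1 _).
  by rewrite setTI.
have E0GS : E0 `<=` (\bigcup_j G j) `|` \bigcup_j S j.
  move=> y E0y; have [|nS] := pselect ((\bigcup_j S j) y); first by right.
  left; have [z [Dz]] := E0D y E0y _ (nbhsx_ballx y (e / 4) ltac:(lra)).
  rewrite ballEmdist/= => yz; have [j _ cj] := Dc z Dz.
  have ex : exists j, mdist (c j) y < r j.
    by exists j; rewrite cj metric_sym (lt_trans yz)//; have [] := Hr j.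
  exists (ex_minn ex) => //; case: ex_minnP => l ly lmin.
  apply/ball_minus_gt0; split=> // k kl.
  rewrite lt_neqAle; apply/andP; split.
    by apply/eqP => rk; apply: nS; exists k.
  by rewrite leNgt; apply/negP => /lmin; rewrite leqNgt kl.
have muG : mu (\bigcup_j G j) = 1%E.
  apply/eqP; rewrite eq_le probability_le1/=; last exact: bigcup_measurable.
  rewrite -muE0.
  have mu0 : mu (\bigcup_j S j) = 0%E.
    apply: measure_negligible; first exact: bigcup_measurable.
    apply: negligible_bigcup => j; apply/negligibleP => //.
    by have [] := Hr j.
  rewrite -[leRHS]adde0 -[X in (_ + X)%E]mu0.
  apply: le_trans (measureU2 _ _ _); try exact: bigcup_measurable.
  by apply: le_measure => //; rewrite inE//; apply: measurableU; exact: bigcup_measurable.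
have cvgG : (mu (\bigcup_(j < m) G j) @[m --> \oo] --> mu (\bigcup_m \bigcup_(j < m) G j))%E.
  apply: nondecreasing_cvg_mu => [m||].
  - exact: bigcup_measurable.
  - by apply: bigcup_measurable => m _; exact: bigcup_measurable.
  - move=> m n mn; apply/subsetPset => x [j /= jm Gj].
    by exists j => //=; exact: leq_trans jm mn.
have UG : \bigcup_m \bigcup_(j < m) G j = \bigcup_j G j.
  apply/seteqP; split=> x; first by move=> [m _ [j _ Gj]]; exists j.
  by move=> [j _ Gj]; exists j.+1 => //; exists j => /=.
rewrite UG muG in cvgG.
have lt1 : ((1 - e)%:E < 1)%E by rewrite lte_fin; lra.
have [N _ /(_ N (leqnn _)) HN] := cvgG _ (open_ereal_gt' lt1).
by exists N, g; split.
Qed.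

End SmallCells.

(** * Mixtures and gluing *)

Lemma mnormalize_scale {d} {S : measurableType d} {R : realType}
    (m : {measure set S -> \bar R}) (P : probability S R) (A : set S) :
  measurable A -> (m setT < +oo)%E -> (m setT * mnormalize m P A = m A)%E.
Proof.
move=> mA moo; rewrite /mnormalize; case: ifPn => [|].
  rewrite orbC lt_eqF//= => /eqP m0; rewrite m0 mul0e; apply/esym/eqP.
  by rewrite -measure_le0 -m0 le_measure// inE.
rewrite negb_or => /andP[m0 _].
have mf : m setT \is a fin_num by rewrite ge0_fin_numE.
rewrite muleCA -{1}(fineK mf) -EFinM divff ?mule1//.
by rewrite fine_eq0.
Qed.

Section Mixture.
Context {d : measure_display} {S : measurableType d} {R : realType}.
Variables (nu : probability S R) (G : nat -> set S) (m : nat) (w : nat -> R).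
Hypotheses (mG : forall j, measurable (G j)) (tG : trivIset setT G).
Hypotheses (w0 : forall j, 0 <= w j).
Hypothesis (wG : forall j, (j < m)%N -> ((w j)%:E <= nu (G j))%E).
Local Open Scope ereal_scope.

Let mU : measurable (~` \big[setU/set0]_(j < m) G j).
Proof. by apply: measurableC; exact: bigsetU_measurable. Qed.

(* When [nu (G j) = 0] the division by 0 makes this coefficient 1, which is
   harmless: [G j] then carries no mass and [w j = 0]. *)
Definition rest_coef (j : nat) : {nonneg R} :=
  NngNum (ltac:(by rewrite le_max lexx) : 0 <= Num.max 0 (1 - w j / fine (nu (G j))))%R.

Definition cell (j : nat) : {measure set S -> \bar R} := mrestr nu (mG j).

Definition rest : {measure set S -> \bar R} :=
  measure_add (mrestr nu mU) (msum (fun j => mscale (rest_coef j) (cell j)) m).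

(** The default for a null cell is a Dirac mass at one of its points, so that the law of a nonempty
    cell is always carried by it. *)
Definition cell_law (j : nat) : probability S R :=
  mnormalize (cell j) (dirac (xget point (G j))).

Let cellT j : cell j setT = nu (G j).
Proof. by rewrite /cell /= /mrestr setTI. Qed.

(** With g the mass of the cell and l the conditional mass of [A], this is (1 - w/g) g l + w l = g
    l; if g = 0, then w = 0. *)
Let cell_split j A : (j < m)%N -> measurable A ->
  (rest_coef j)%:num%:E * cell j A + (w j)%:E * cell_law j A = nu (A `&` G j).
Proof.
move=> jm mA; have fG : nu (G j) \is a fin_num by exact: fin_num_measure.
have mAG : measurable (A `&` G j) by exact: measurableI.
have fAG : nu (A `&` G j) \is a fin_num by exact: fin_num_measure.
have : nu (G j) * cell_law j A = nu (A `&` G j).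
  rewrite -cellT; apply: mnormalize_scale => //.
  by rewrite cellT -ge0_fin_numE.
have fL : cell_law j A \is a fin_num by exact: fin_num_measure.
have -> : cell j A = nu (A `&` G j) by [].
have := wG j jm; have := w0 j.
rewrite -(fineK fG) -(fineK fAG) -(fineK fL) -!EFinM -EFinD lee_fin/=.
set g := fine (nu (G j)); set l := fine _; set a := fine _.
move=> w0' wg gl'; congr (_%:E).
have gl : (g * l = a)%R by apply: EFin_inj; exact: gl'.
rewrite -gl.
have [g0|g0] := eqVneq g 0%R.
  have -> : w j = 0%R by apply/eqP; rewrite eq_le w0' -g0 wg.
  by rewrite g0 !mul0r mulr0 addr0.
have gp : (0 < g)%R by rewrite lt_neqAle eq_sym g0 (le_trans w0').
rewrite max_r; first by field.
by rewrite subr_ge0 ler_pdivrMr// mul1r.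
Qed.

Let restE A : measurable A ->
  rest A + \sum_(j < m) (w j)%:E * cell_law j A = nu A.
Proof.
move=> mA.
have -> : rest A = nu (A `&` ~` \big[setU/set0]_(j < m) G j) +
    \sum_(j < m) (rest_coef j)%:num%:E * cell j A.
  exact: measure_addE.
rewrite -addeA -big_split/=.
rewrite (eq_bigr (fun j : 'I_m => nu (A `&` G j))); last first.
  by move=> j _; rewrite cell_split.
have mUG : measurable (\big[setU/set0]_(j < m) G j) by exact: bigsetU_measurable.
rewrite [RHS](measureDI nu mA mUG) setDE.
congr (_ + _); rewrite big_distrr/=.
rewrite (measure_bigsetU nu (F := fun j => A `&` G j))//.
- by move=> j; exact: measurableI.
- exact: trivIset_setIl.
Qed.

(** Index [m] holds the normalised residual, whose total mass is what the weights leave over. An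
    empty cell carries no probability, hence the condition in the second clause. *)
Lemma mixture_decomposition : exists kappa : nat -> probability S R,
  (forall A, measurable A -> nu A =
    \sum_(j < m) (w j)%:E * kappa j A + (1 - \sum_(j < m) w j)%:E * kappa m A) /\
  (forall j, (j < m)%N -> G j !=set0 -> kappa j (~` G j) = 0).
Proof.
have restT : rest setT = (1 - \sum_(j < m) w j)%:E.
  have := restE setT measurableT; rewrite probability_setT.
  under eq_bigr do rewrite probability_setT mule1.
  by rewrite sumEFin EFinB => <-; rewrite addeK.
exists (fun j => if (j < m)%N then cell_law j else mnormalize rest nu); split.
  move=> A mA; rewrite ltnn -restT mnormalize_scale//; last first.
    by rewrite restT ltry.
  rewrite -[LHS](restE A mA) addeC; congr (_ + _).
  by apply: eq_bigr => j _; rewrite ltn_ord.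
move=> j jm [x Gx]; rewrite jm /cell_law /= /mnormalize cellT.
case: ifPn => _.
  have : \d_(xget point (G j)) (~` G j) = 0 :> \bar R.
    by rewrite diracE memNset//= => H; apply: H; exact: (xgetI _ Gx).
  exact.
by rewrite /= /mrestr setICl measure0 mul0e.
Qed.

End Mixture.

(** [l n] is the largest [k <= n] with [H k n]: level 0 is always available, and the bound [k <= n]
    makes the maximum exist. *)
Lemma diagonal_level (H : nat -> nat -> Prop) : (forall n, H 0 n) ->
  (forall k, \forall n \near \oo, H k n) ->
  exists l : nat -> nat, (forall n, H (l n) n) /\
    forall K, \forall n \near \oo, (K <= l n)%N.
Proof.
move=> H0 Hk; pose P n k := (k <= n)%N && `[<H k n>].
have exP n : exists k, P n k by exists 0; rewrite /P leq0n/=; apply/asboolP.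
have ubP n k : P n k -> (k <= n)%N by case/andP.
exists (fun n => ex_maxn (exP n) (ubP n)); split=> [n|K].
  by case: ex_maxnP => k /andP[_ /asboolP].
near=> n; case: ex_maxnP => k _; apply; rewrite /P; apply/andP; split.
  by near: n; exact: nbhs_infty_ge.
by apply/asboolP; near: n.
Unshelve. all: by end_near. Qed.

Section CellIndex.
Context {T : Type} (G : nat -> set T) (m : nat).
Hypothesis tG : trivIset setT G.

(** [find] returns [m] when no cell contains [x], and [m] is the index of the residual law. *)
Definition cell_index (x : T) : nat := find (fun j => `[<G j x>]) (iota 0 m).

Lemma cell_index_le x : (cell_index x <= m)%N.
Proof. by rewrite -[leqRHS](size_iota 0) find_size. Qed.

Lemma cell_indexP x j : (j < m)%N -> cell_index x = j <-> G j x.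
Proof.
move=> jm; split=> [xj|Gj].
  have := @nth_find _ 0 (fun j => `[<G j x>]) (iota 0 m).
  rewrite has_find size_iota -/(cell_index x) xj jm nth_iota// add0n.
  by move=> /(_ isT) /asboolP.
have Hj : has (fun j => `[<G j x>]) (iota 0 m).
  by apply/hasP; exists j; rewrite ?mem_iota//; exact/asboolP.
have := @nth_find _ 0 _ _ Hj; rewrite has_find size_iota in Hj.
rewrite nth_iota// add0n => /asboolP Gi.
by apply: (tG _ _ I I); exists x.
Qed.

End CellIndex.

(** * Gluing random elements along an independent random index *)

Section Gluing.
Context {R : realType} {d1 d2 d : measure_display} {T1 : measurableType d1}
  {T2 : measurableType d2} {S : measurableType d}.
Variables (Q1 : probability T1 R) (Q2 : probability T2 R).
Variables (J : T1 -> nat) (V : nat -> T2 -> S).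
Hypotheses (mJ : forall j, measurable [set x | J x = j]).
Hypotheses (mV : forall j, measurable_fun setT (V j)).

Definition glue (z : T1 * T2) : S := V (J z.1) z.2.

(** Slicing by the countably valued index yields rectangles, from which both measurability and the
    law follow. *)
Lemma glue_preimage A : glue @^-1` A =
  \bigcup_j ([set x | J x = j] `*` (V j @^-1` A)).
Proof.
apply/seteqP; split=> [[x y] /= Axy|[x y] [j _ [/= <-]]//].
by exists (J x).
Qed.

Let mrect j A : measurable A -> measurable ([set x | J x = j] `*` (V j @^-1` A)).
Proof. by move=> mA; apply: measurableX => //; rewrite -[X in measurable X]setTI; exact: mV. Qed.

Lemma measurable_glue : measurable_fun setT glue.
Proof.
move=> _ A mA; rewrite setTI glue_preimage; apply: bigcup_measurable => j _.
exact: mrect.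
Qed.

Lemma glue_law (m : nat) A : (forall x, (J x <= m)%N) -> measurable A ->
  ((Q1 \x Q2) (glue @^-1` A) =
   \sum_(j < m.+1) Q1 [set x | J x = j] * Q2 (V j @^-1` A))%E.
Proof.
move=> Jm mA; rewrite glue_preimage.
have -> : \bigcup_j ([set x | J x = j] `*` (V j @^-1` A)) =
    \big[setU/set0]_(j < m.+1) ([set x | J x = j] `*` (V j @^-1` A)).
  rewrite -(bigcup_mkord m.+1 (fun j => [set x | J x = j] `*` (V j @^-1` A))).
  apply/seteqP; split=> [[x y] [j _ [/= xj Vy]]|z [j _ ?]].
    by exists j => //=; rewrite -xj ltnS.
  by exists j.
rewrite (measure_bigsetU (Q1 \x Q2)%E
  (F := fun j => [set x | J x = j] `*` (V j @^-1` A)))//; last 2 first.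
- by move=> j; exact: mrect.
- by apply/trivIsetP => i j _ _ /eqP ij; apply/seteqP; split=> // -[x y] [[/= -> _] [/=]].
apply: eq_bigr => j _; apply: product_measure1E => //.
by rewrite -[X in measurable X]setTI; exact: mV.
Qed.

End Gluing.

Section NullModification.
Context {R : realType} {d d' : measure_display} {T : measurableType d}
  {S : measurableType d'}.
Variables (Q : probability T R) (N : set T) (f : T -> S).
Hypotheses (mN : measurable N) (QN : Q N = 0%E) (mf : measurable_fun setT f).

(** Resetting on a null set keeps the law and turns almost sure convergence into convergence
    everywhere. *)
Definition modify_on : T -> S := fun z => if z \in N then point else f z.

Lemma measurable_modify_on : measurable_fun setT modify_on.
Proof.
apply: measurable_fun_ifT => //; apply: (measurable_fun_bool true).
rewrite setTI (_ : _ @^-1` _ = N)//.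
by apply/seteqP; split=> z /=; [exact: set_mem|exact: mem_set].
Qed.

Lemma modify_on_law A : measurable A -> Q (modify_on @^-1` A) = Q (f @^-1` A).
Proof.
move=> mA.
have mB g : measurable_fun setT g -> measurable (g @^-1` A : set T).
  by move=> mg; rewrite -[X in measurable X]setTI; exact: mg.
have QD B : measurable B -> Q B = Q (B `\` N).
  move=> mB'; rewrite (measureDI Q mB' mN) -[RHS]adde0; congr (_ + _)%E.
  apply/eqP; rewrite -measure_le0 -QN le_measure// inE//.
  exact: measurableI.
rewrite QD; last exact: mB measurable_modify_on.
rewrite [RHS]QD; last exact: mB.
congr (Q _); apply/seteqP; split=> z [/=].
  by rewrite /modify_on; case: ifPn => // /set_mem Nz _ /(_ Nz).
by move=> Az nN; split=> //=; rewrite /modify_on memNset.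
Qed.

End NullModification.

Lemma uniform_prob_le {R : realType} (a : R) : 0 <= a -> a <= 1 ->
  uniform_prob (@ltr01 R) [set u | u <= a] = a%:E.
Proof.
move=> a0 a1; rewrite /uniform_prob integral_uniform_pdf.
have -> : [set u | u <= a] `&` `[0, 1]%classic = `[0, a]%classic.
  apply/seteqP; split=> u /=; rewrite !in_itv/=; first by move=> [-> /andP[-> _]].
  by move=> /andP[u0 ua]; rewrite ua u0 (le_trans ua).
rewrite (eq_integral (fun=> 1%E)); last first.
  move=> u; rewrite inE/= in_itv/= => /andP[u0 ua].
  by rewrite /uniform_pdf u0 (le_trans ua)//= subr0 invr1.
rewrite integral_cst//= mul1e lebesgue_measure_itv/= lte_fin.
case: ltP => [|a0']; first by rewrite -EFinD subr0.
by congr (_%:E); apply/eqP; rewrite eq_le a0.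
Qed.

(** * The representation theorem *)

Section Representation.
Context {R : realType} {E : pmetricType R}.
Variables (mu_ : nat -> probability (borel E) R) (mu : probability (borel E) R).
Hypothesis mu_cvg : forall h : E -> R, continuous h -> bounded_fun h ->
  (\int[mu_ n]_x (h x)%:E @[n --> \oo] --> \int[mu]_x (h x)%:E)%E.
Variable E0 : set E.
Hypotheses (mE0 : measurable (E0 : set (borel E))) (sepE0 : separable_set E0).
Hypothesis muE0 : mu E0 = 1%E.

(** The matched share of each cell at level [k]: it is 0 at level 0, which is thus admissible for
    every [n], and it tends to 1 from below. *)
Let fidelity (k : nat) : R := 1 - k.+1%:R^-1.

Let fidelity_ge0 k : 0 <= fidelity k.
Proof. by rewrite subr_ge0 invf_le1 ?ler1n ?ltr0n. Qed.

Let fidelity_lt1 k : fidelity k < 1.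
Proof. by rewrite ltrBlDr ltrDl invr_gt0 ltr0n. Qed.

(** Bounds both the diameters and the uncovered mass at level [k]; it is summable, for
    Borel-Cantelli. *)
Let mesh (k : nat) : R := 1 / (2 ^ k.+1)%:R.

Let mesh_gt0 k : 0 < mesh k.
Proof. by rewrite divr_gt0// ltr0n expn_gt0. Qed.

Let mesh_le k : mesh k <= k.+1%:R^-1.
Proof.
by rewrite /mesh div1r lef_pV2 ?posrE ?ltr0n ?expn_gt0// ler_nat ltnW// ltn_expl.
Qed.

Lemma exists_slow_refinement : exists (m : nat -> nat) (G : nat -> nat -> set (borel E))
    (l : nat -> nat),
  [/\ forall k j, measurable (G k j),
      forall k, trivIset setT (G k),
      forall k j x y, G k j x -> G k j y -> mdist (x : E) (y : E) < k.+1%:R^-1,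
      mu (lim_sup_set (fun k => ~` \bigcup_(j < m k) G k j)) = 0%E &
      (forall n j, (j < m (l n))%N ->
        ((fidelity (l n))%:E * mu (G (l n) j) <= mu_ n (G (l n) j))%E) /\
      forall K, \forall n \near \oo, (K <= l n)%N].
Proof.
have /choice[m /choice[g Hg]] := fun k =>
  small_disjoint_cells mu E0 (mesh k) mE0 sepE0 muE0 (mesh_gt0 k).
pose G k j : set (borel E) := [set x | 0 < g k j x].
have cg k j : continuous (g k j) by have [] := Hg k.
have mG k j : measurable (G k j).
  have := continuous_measurable_borel _ (cg k j) measurableT `]0%R, +oo[%classic
    (measurable_itv _).
  by rewrite setTI; congr measurable; apply/seteqP; split=> x /=;
    rewrite in_itv/= andbT.
pose H k n := forall j, (j < m k)%N ->
  ((fidelity k)%:E * mu (G k j) <= mu_ n (G k j))%E.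
have H0 n : H 0 n.
  by move=> j _; rewrite /fidelity invr1 subrr mul0e.
have Hk k : \forall n \near \oo, H k n.
  have near_j j : \forall n \near \oo,
      ((fidelity k)%:E * mu (G k j) <= mu_ n (G k j))%E.
    have fG : mu (G k j) \is a fin_num by exact: fin_num_measure.
    (* For a cell of positive mass, [fidelity k < 1] gives the strict inequality that
       [near_lt_mass_pos] demands. *)
    have [G0|G0] := eqVneq (mu (G k j)) 0%E.
      by apply: nearW => n; rewrite G0 mule0.
    have Gp : 0 < fine (mu (G k j)).
      by rewrite fine_gt0// -ge0_fin_numE// fG lt_neqAle eq_sym G0 measure_ge0.
    rewrite -(fineK fG) -EFinM.
    have lt : ((fidelity k * fine (mu (G k j)))%:E < mu (G k j))%E.
      by rewrite -[ltRHS](fineK fG) lte_fin gtr_pMl// fidelity_lt1.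
    have := near_lt_mass_pos mu_ mu mu_cvg (g k j) _ (cg k j) lt.
    by apply: filterS => n /ltW.
  rewrite /H; elim: (m k) => [|i IH]; first by apply: nearW.
  near=> n => j; rewrite ltnS leq_eqVlt => /predU1P[->|]; first by near: n; exact: near_j.
  by move: j; near: n.
have [l [Hl lK]] := diagonal_level H H0 Hk.
exists m, G, l; split=> //.
- by move=> k; have [] := Hg k.
- move=> k j x y Gx Gy; apply: lt_le_trans (mesh_le k).
  by have [_ _ + _] := Hg k; apply; [exact: Gx|exact: Gy].
(* Borel-Cantelli: the uncovered masses are at most [mesh k], with sum at most 1. *)
apply: lim_sup_set_cvg0 => [k|].
  by apply: measurableC; exact: bigcup_measurable.
apply: (@le_lt_trans _ _ 1%E); last exact: ltry.
apply: le_trans (epsilon_trick0 xpredT ler01).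
apply: lee_nneseries => // k _.
have mUG : measurable (\bigcup_(j < m k) G k j) by exact: bigcup_measurable.
rewrite [leLHS](_ : _ = 1 - mu (\bigcup_(j < m k) G k j))%E; last exact: probability_setC.
have fU : mu (\bigcup_(j < m k) G k j) \is a fin_num by exact: fin_num_measure.
have [_ _ _] := Hg k; rewrite -/(G k) -(fineK fU) lte_fin lee_fin /mesh; lra.
Unshelve. all: by end_near. Qed.

Lemma representation_of_laws : exists (dO : measure_display) (O : measurableType dO)
    (Q : probability O R) (Y_ : nat -> O -> borel E) (Y : O -> borel E),
  [/\ forall n, measurable_fun setT (Y_ n), measurable_fun setT Y,
    forall n A, measurable A -> Q (Y_ n @^-1` A) = mu_ n A,
    forall A, measurable A -> Q (Y @^-1` A) = mu A &
    cvg_pointwise (Y_ : nat -> O -> E) (Y : O -> E)].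
Proof.
have [m [G [l [mG tG smallG limG [Gl lK]]]]] := exists_slow_refinement.
pose a n := fidelity (l n).
pose w n j : R := a n * fine (mu (G (l n) j)).
have w0 n j : 0 <= w n j by rewrite mulr_ge0// ?fidelity_ge0// fine_ge0.
have wE n j : (w n j)%:E = ((a n)%:E * mu (G (l n) j))%E.
  by rewrite EFinM fineK// fin_num_measure.
have wG n j : (j < m (l n))%N -> ((w n j)%:E <= mu_ n (G (l n) j))%E.
  by move=> jm; rewrite wE; exact: Gl.
have /choice[kappa Hk] := fun n =>
  mixture_decomposition (mu_ n) (G (l n)) (m (l n)) (w n) (mG (l n)) (tG (l n)) (w0 n) (wG n).
(* Pairs [(n, j)] are coded by one natural number; [kappa 0 0] fills the numbers that code no
   pair. *)
have [dW [W [Q' [V' HV']]]] := exists_coupling_of_laws (fun p : nat =>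
  if unpickle p is Some (n, j) then kappa n j else kappa 0 0).
pose V (n j : nat) : W -> borel E := V' (pickle (n, j)).
have mV n j : measurable_fun setT (V n j) by have [] := HV' (pickle (n, j)).
have lawV n j A : measurable A -> Q' (V n j @^-1` A) = kappa n j A.
  by move=> mA; have [_ /(_ A mA)] := HV' (pickle (n, j)); rewrite pickleK.
pose U : probability (measurableTypeR R) R := uniform_prob (@ltr01 R).
pose Q1 : probability (borel E * measurableTypeR R)%type R := (mu \x U)%E.
(* The residual index [m (l n)] arises in two ways: [p.2] exceeds [a n], or [p.1] lies in no
   cell. *)
pose J n (p : borel E * measurableTypeR R) :=
  if p.2 <= a n then cell_index (G (l n)) (m (l n)) p.1 else m (l n).
have Jle n p : (J n p <= m (l n))%N.
  by rewrite /J; case: ifP => // _; exact: cell_index_le.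
have JE n j : (j < m (l n))%N ->
    [set p | J n p = j] = G (l n) j `*` [set u | u <= a n].
  move=> jm; apply/seteqP; split=> [[y u]|[y u] [/= Gy ua]]; rewrite /J/=.
    case: ifPn => [ua /(cell_indexP _ _ (tG _) _ _ jm)//|_ mj].
    by rewrite mj ltnn in jm.
  by rewrite ua; apply/(cell_indexP _ _ (tG _)).
have mle n : measurable [set u : R | u <= a n].
  have := measurable_itv (`]-oo, a n] : interval R).
  by congr measurable; apply/seteqP; split=> u /=; rewrite in_itv.
have mJlt n j : (j < m (l n))%N -> measurable [set p | J n p = j].
  by move=> jm; rewrite JE//; apply: measurableX => //; exact: mle.
have JmC n : [set p | J n p = m (l n)] =
    ~` \big[setU/set0]_(j < m (l n)) [set p | J n p = j].
  rewrite -(bigcup_mkord _ (fun j => [set p | J n p = j])); apply/seteqP; split=> p /=.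
    by move=> pm [j /= jm pj]; rewrite -pj pm ltnn in jm.
  move=> nJ; apply/eqP; rewrite eqn_leq Jle leqNgt /=; apply/negP => lt.
  by apply: nJ; exists (J n p).
have mJ n j : measurable [set p | J n p = j].
  have [/mJlt//|] := ltnP j (m (l n)); rewrite leq_eqVlt => /predU1P[<-|mj].
    rewrite JmC; apply: measurableC; apply: bigsetU_measurable => i _.
    exact: mJlt.
  rewrite (_ : [set p | _] = set0)//; apply/seteqP; split=> // p /= pj.
  by have := Jle n p; rewrite pj leqNgt mj.
have Q1J n j : (j < m (l n))%N -> Q1 [set p | J n p = j] = (w n j)%:E.
  move=> jm; rewrite JE// wE muleC -(uniform_prob_le (a n)) ?fidelity_ge0//.
    by apply: product_measure1E => //; exact: mle.
  exact: ltW (fidelity_lt1 _).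
have Q1Jm n : Q1 [set p | J n p = m (l n)] = (1 - \sum_(j < m (l n)) w n j)%:E.
  rewrite JmC probability_setC; last by apply: bigsetU_measurable.
  rewrite (measure_bigsetU Q1 (F := fun j => [set p | J n p = j]))//; last first.
    by apply/trivIsetP => i j _ _ /eqP ij; apply/seteqP; split=> // p [/= ->].
  by rewrite EFinB -sumEFin; congr (_ - _)%E; apply: eq_bigr => j _; exact: Q1J.
pose Q : probability (borel E * measurableTypeR R * W)%type R := (Q1 \x Q')%E.
pose Z n := glue (J n) (V n).
have mZ n : measurable_fun setT (Z n) by exact: measurable_glue.
(* The index probabilities [Q1J] and [Q1Jm] are exactly the weights in the decomposition of
   [mu_ n]. *)
have lawZ n A : measurable A -> Q (Z n @^-1` A) = mu_ n A.
  move=> mA; have [muE _] := Hk n; rewrite [RHS]muE//.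
  have -> : Q (Z n @^-1` A) =
      (\sum_(j < (m (l n)).+1) Q1 [set p | J n p = j] * Q' (V n j @^-1` A))%E.
    by apply: glue_law.
  rewrite big_ord_recr/= Q1Jm lawV//.
  by congr (_ + _)%E; apply: eq_bigr => j _; rewrite Q1J// lawV.
pose Y (z : borel E * measurableTypeR R * W) : borel E := z.1.1.
have mY : measurable_fun setT Y.
  exact: measurableT_comp measurable_fst measurable_fst.
have lawY A : measurable A -> Q (Y @^-1` A) = mu A.
  move=> mA; have -> : Y @^-1` A = (A `*` setT) `*` setT.
    by apply/seteqP; split=> [[[y u] o]|[[y u] o] [[]]].
  transitivity (Q1 (A `*` setT) * Q' setT)%E.
    by apply: product_measure1E => //; exact: measurableX.
  rewrite probability_setT mule1 -[RHS]mule1 -(probability_setT U).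
  by apply: product_measure1E.
(* Three null events are discarded: here, that [Y] misses the cells of infinitely many levels. *)
pose B := lim_sup_set (fun k => ~` \bigcup_(j < m k) G k j).
have mB : measurable B.
  apply: bigcapT_measurable => k; apply: bigcup_measurable => j _.
  by apply: measurableC; exact: bigcup_measurable.
(* Second, that some [V n j] falls outside its nonempty cell. *)
pose M n j := if (j < m (l n))%N && `[<G (l n) j !=set0>] then V n j @^-1` (~` G (l n) j) else set0.
have mM n j : measurable (M n j).
  rewrite /M; case: ifP => // _; rewrite -[X in measurable X]setTI; apply: mV => //.
  exact: measurableC.
have M0 n j : Q' (M n j) = 0%E.
  rewrite /M; case: ifP => [/andP[jm /asboolP Gne]|_]; last exact: measure0.
  rewrite lawV; last exact: measurableC.
  by have [_] := Hk n; apply.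
(* Third, that the uniform variable is at least 1; below 1 it is eventually at most [a n]. *)
pose C := [set u : R | 1 <= u].
have mC : measurable C.
  have := measurable_itv (`[1, +oo[ : interval R).
  by congr measurable; apply/seteqP; split=> u /=; rewrite in_itv/= andbT.
have UC : U C = 0%E.
  apply/eqP; rewrite -measure_le0; apply/lee_addgt0Pr => e e0; rewrite add0e.
  have [k _ /(_ k (leqnn _)) ke] := near_infty_natSinv_lt (PosNum e0).
  have mk : measurable [set u : R | u <= fidelity k].
    have := measurable_itv (`]-oo, fidelity k] : interval R).
    by congr measurable; apply/seteqP; split=> u /=; rewrite in_itv.
  apply: (@le_trans _ _ (U (~` [set u | u <= fidelity k]))).
    rewrite le_measure ?inE//; first exact: measurableC.
    by move=> u /= u1; apply/negP; rewrite -ltNge (lt_le_trans (fidelity_lt1 k)).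
  have Uk : U [set u | u <= fidelity k] = (fidelity k)%:E.
    by apply: uniform_prob_le; rewrite ?fidelity_ge0// ltW// fidelity_lt1.
  rewrite probability_setC// Uk.
  by rewrite -EFinB lee_fin /fidelity opprB addrCA subrr addr0 ltW.
pose N := (B `*` setT `*` setT) `|` (setT `*` C `*` setT) `|`
  (setT `*` \bigcup_n \bigcup_j M n j).
have mM' : measurable (\bigcup_n \bigcup_j M n j).
  by apply: bigcup_measurable => n _; exact: bigcup_measurable.
have mN : measurable N.
  by apply: measurableU; [apply: measurableU|]; do ?apply: measurableX.
have QN : Q N = 0%E.
  have mBT : measurable (B `*` [set: R]) by exact: measurableX.
  have mTC : measurable ([set: borel E] `*` C) by exact: measurableX.
  have QX A1 A2 : measurable A1 -> measurable A2 -> Q1 A1 = 0%E \/ Q' A2 = 0%E ->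
      Q.-negligible (A1 `*` A2).
    move=> mA1 mA2 A0; apply/negligibleP; first exact: measurableX.
    transitivity (Q1 A1 * Q' A2)%E; first exact: product_measure1E.
    by case: A0 => ->; rewrite ?mul0e ?mule0.
  have Q1X A1 A2 : measurable A1 -> measurable A2 -> mu A1 = 0%E \/ U A2 = 0%E ->
      Q1 (A1 `*` A2) = 0%E.
    move=> mA1 mA2 A0.
    transitivity (mu A1 * U A2)%E; first exact: product_measure1E.
    by case: A0 => ->; rewrite ?mul0e ?mule0.
  apply: measure_negligible => //; apply: negligibleU; [apply: negligibleU|].
  - by apply: QX => //; left; apply: Q1X => //; left.
  - by apply: QX => //; left; apply: Q1X => //; right.
  - apply: QX => //; right; apply: measure_negligible => //.
    apply: negligible_bigcup => n; apply: negligible_bigcup => j.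
    by apply/negligibleP; [exact: mM|exact: M0].
exists _, (borel E * measurableTypeR R * W)%type, Q, (fun n => modify_on N (Z n)), (modify_on N Y).
split.
- by move=> n; exact: measurable_modify_on.
- exact: measurable_modify_on.
- by move=> n A mA; rewrite modify_on_law// lawZ.
- by move=> A mA; rewrite modify_on_law// lawY.
move=> z; rewrite /modify_on; case: ifPn => zN.
  by rewrite mdistxx; exact: cvg_cst.
move: zN; rewrite notin_setE /N; case: z => [[y u] o] nN.
have yB : ~ B y by move=> By; apply: nN; left; left.
have u1 : u < 1 by rewrite ltNge; apply/negP => Cu; apply: nN; left; right.
have oM : ~ (\bigcup_n \bigcup_j M n j) o by move=> Mo; apply: nN; right.
have [K1 HK1] : exists K, forall k, (K <= k)%N -> (\bigcup_(j < m k) G k j) y.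
  apply/not_existsP => H; apply: yB => K _.
  have /existsNP[k /not_implyP[Kk nk]] := H K.
  by exists k.
have u1' : 0 < 1 - u by rewrite subr_gt0.
apply/cvgrPdist_lt => e e0.
(* From level [K2] on, 1/(k+1) < 1 - u, that is, u is below the fidelity; from level [K3] on, cell
   diameters are below [e]. *)
have [K2 _ HK2] := near_infty_natSinv_lt (PosNum u1').
have [K3 _ HK3] := near_infty_natSinv_lt (PosNum e0).
have := lK (maxn K1 (maxn K2 K3)); apply: filterS => n.
rewrite !geq_max => /and3P[/HK1[j /= jm Gy] /HK2/= k2 /HK3/= k3].
have Jj : J n (y, u) = j.
  apply: (_ : [set p | J n p = j] (y, u)); rewrite JE//; split=> //=.
  by rewrite /a /fidelity lerBrDr -lerBrDl; exact: ltW k2.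
(* The cell contains [y], hence is nonempty; a value outside it would put [o] in [M n j]. *)
have GV : G (l n) j (V n j o).
  apply: contrapT => nG; apply: oM; exists n => //; exists j => //.
  rewrite /M jm/=; case: asboolP => // -[]; by exists y.
rewrite /Z /glue /= Jj sub0r normrN ger0_norm ?mdist_ge0//.
exact: lt_trans (smallG _ _ _ _ GV Gy) k3.
Qed.

End Representation.

(** * The converse implication and the equivalence *)

Lemma cvg_integral_of_cvg_pointwise {R : realType} {E : pmetricType R}
    {d : measure_display} {O : measurableType d} (Q : probability O R)
    (Y_ : nat -> O -> borel E) (Y : O -> borel E) (h : E -> R) :
  (forall n, measurable_fun setT (Y_ n)) -> measurable_fun setT Y ->
  cvg_pointwise (Y_ : nat -> O -> E) (Y : O -> E) ->
  continuous h -> bounded_fun h ->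
  (\int[Q]_w (h (Y_ n w))%:E @[n --> \oo] --> \int[Q]_w (h (Y w))%:E)%E.
Proof.
(* [bounded_fun] bounds [h] by every number above [M]; [M + 1] serves as the dominating constant. *)
move=> mY_ mY YY ch [M [_ /(_ (M + 1))]]; rewrite ltrDl ltr01 => /(_ isT) hM.
have mh := continuous_measurable_borel h ch.
have hcvg w : h (Y_ n w) @[n --> \oo] --> h (Y w).
  suff cY : (Y_ n w : E) @[n --> \oo] --> (Y w : E).
    exact: (cvg_comp (fun n => Y_ n w : E) h cY (ch (Y w))).
  apply/cvg_ballP => e e0; rewrite ballEmdist.
  have /cvgrPdist_lt/(_ e e0) := YY w; apply: filterS => n /=.
  by rewrite sub0r normrN ger0_norm ?mdist_ge0// metric_sym.
apply: (@dominated_cvg _ _ _ Q setT measurableT (fun n w => (h (Y_ n w))%:E) _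
  (cst (M + 1)%:E)).
- by move=> n; apply/measurable_EFinP; exact: measurableT_comp.
- by move=> w _; apply/fine_cvgP; split; [exact: nearW|exact: hcvg].
- by [].
- exact: finite_measure_integrable_cst.
- by move=> n w _ /=; rewrite lee_fin; exact: hM.
Qed.

Lemma integral_same_distribution {R : realType} {d d1 d2 : measure_display}
    {S : measurableType d} {T1 : measurableType d1} {P1 : probability T1 R}
    {T2 : measurableType d2} {P2 : probability T2 R}
    (X1 : {RV P1 >-> S}) (X2 : {RV P2 >-> S}) (f : S -> \bar R) :
  same_distribution X1 X2 ->
  (\int[distribution P1 X1]_x f x = \int[distribution P2 X2]_x f x)%E.
Proof.
move=> H; apply: eq_measure_integral => A mA _; exact: H.
Qed.

Theorem theorem2 (R : realType) (E : pmetricType R)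
    (d_ : nat -> measure_display) (T_ : forall n, measurableType (d_ n))
    (P_ : forall n, probability (T_ n) R)
    (X_ : forall n, {RV (P_ n) >-> borel E})
    (d : measure_display) (T : measurableType d) (P : probability T R)
    (X : {RV P >-> borel E})
    (E0 : set E)
    (mE0 : measurable (E0 : set (borel E)))
    (sepE0 : separable_set E0)
    (XE0 : {ae P, forall w, E0 (X w)}) :
  cvg_in_distribution X_ X <->
  exists (dO : measure_display) (O : measurableType dO) (Q : probability O R)
    (Y_ : nat -> {RV Q >-> borel E}) (Y : {RV Q >-> borel E}),
    coupling X_ X Y_ Y /\ cvg_pointwise (Y_ : nat -> O -> E) (Y : O -> E).
Proof.
split=> [XX|[dO [W [Q [Y_ [Y [[lawY_ lawY] YY]]]]]]].
  have XE01 : distribution P X E0 = 1%E.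
    have mXE0 : measurable (X @^-1` E0) by exact: measurable_funPTI.
    have := probability_setC P (measurableC mXE0).
    rewrite setCK (measure_negligible _ (XE0 : P.-negligible (~` (X @^-1` E0)))).
      by rewrite sube0.
    exact: measurableC.
  have [dO [W [Q [Y_ [Y [mY_ mY lawY_ lawY YY]]]]]] :=
    representation_of_laws (fun n => distribution (P_ n) (X_ n)) (distribution P X)
      XX E0 mE0 sepE0 XE01.
  exists dO, W, Q, (fun n => mfun_Sub (mem_set (mY_ n) : Y_ n \in mfun)),
    (mfun_Sub (mem_set mY : Y \in mfun)).
  by split.
move=> h ch bh.
(* Integrals against the laws are moved to the common space [W], where dominated convergence
   applies. *)
have intE (Z : {RV Q >-> borel E}) :
    (\int[distribution Q Z]_x (h x)%:E = \int[Q]_w (h (Z w))%:E)%E.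
  have mh := continuous_measurable_borel h ch.
  rewrite integral_distribution//; first exact/measurable_EFinP.
  apply: (measurable_bounded_integrable measurableT).
  - exact: le_lt_trans (probability_le1 Q measurableT) (ltry _).
  - exact: measurableT_comp.
  - by case: bh => M [Mr HM]; exists M; split=> // N /HM hN w _; exact: hN.
rewrite -(integral_same_distribution Y X)//.
have -> : (fun n => \int[distribution (P_ n) (X_ n)]_x (h x)%:E)%E =
    (fun n => \int[Q]_w (h (Y_ n w))%:E)%E.
  by apply/funext => n; rewrite -intE; apply/esym/integral_same_distribution; exact: lawY_.
by rewrite intE; apply: cvg_integral_of_cvg_pointwise.
Qed.
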